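(* Let $q\ge1$, $p=q-1$, and let $A=(a_1,\ldots,a_p)$, $B=(b_1,\ldots,b_q)$ be vectors of positive real numbers. Let $c>0$ be given by $$c=\max_{i\in\{1,2,\ldots,q\}}\left[\frac{e_i(b_1,\ldots,b_q)-e_i(a_1,\ldots,a_p)}{e_{i-1}(a_1,\ldots,a_p)}\right],$$ where $e_q(a_1,\ldots,a_p)=0$. Then for all $x\ge0$ $$e^{\sqrt{4x+c^2}-c}\left(\frac12+\frac{1}{2c}\sqrt{4x+c^2}\right)^{-c}\le{}_{q-1}F_q(A;B;x).$$
   Context: ${}_pF_q(A;B;x)=\sum_{n\ge 0}\frac{(a_1)_n\cdots(a_p)_n}{(b_1)_n\cdots(b_q)_n\,n!}x^n$, where $(a)_0=1$, $(a)_n=a(a+1)\cdots(a+n-1)$; empty products equal $1$. The elementary symmetric polynomials are $e_0=1$, $e_k(x_1,\ldots,x_m)=\sum_{1\le j_1<\cdots<j_k\le m}x_{j_1}\cdots x_{j_k}$ for $1\le k\le m$, and $e_k(x_1,\ldots,x_m)=0$ for $k>m$. *)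

(* Defs.v *)
From mathcomp Require Import all_boot all_order all_algebra.
From mathcomp Require Import all_classical all_reals all_analysis.
(* Not imported: its notations clash with those of mathcomp-analysis. *)
From mathcomp Require mpoly.

Set Implicit Arguments.
Unset Strict Implicit.
Unset Printing Implicit Defensive.

Import Order.TTheory GRing.Theory Num.Theory.
Import numFieldNormedType.Exports.

Local Open Scope ring_scope.

(* The rising factorial (a)_n = a (a + 1) ... (a + n - 1). *)
Definition rising (R : realType) (a : R) (n : nat) : R :=
  \prod_(k < n) (a + k%:R).

Definition hypergeo_coeff (R : realType) (p q : nat)
    (a : 'I_p -> R) (b : 'I_q -> R) (n : nat) : R :=
  (\prod_(i < p) rising (a i) n) / ((\prod_(i < q) rising (b i) n) * n`!%:R).

(* pFq(a; b; x), as the limit of the partial sums.  As for every [limn], the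
   value is meaningful only where the series converges; when p <= q and no b i
   is a nonpositive integer, that is everywhere. *)
Definition hypergeo (R : realType) (p q : nat)
    (a : 'I_p -> R) (b : 'I_q -> R) (x : R) : R :=
  limn (series (fun n => hypergeo_coeff a b n * x ^+ n)).

Definition esym (R : realType) (m : nat) (x : 'I_m -> R) (k : nat) : R :=
  mpoly.meval x (mpoly.mesym m R k).

Lemma esymE (R : realType) (m : nat) (x : 'I_m -> R) (k : nat) :
  esym x k = \sum_(h : {set 'I_m} | #|h| == k) \prod_(j in h) x j.
Proof.
rewrite /esym /mpoly.mesym.
rewrite (big_morph _ (mpoly.mevalD x) (mpoly.meval0 x)); apply: eq_bigr => h _.
rewrite (big_morph _ (mpoly.mevalM x) (mpoly.meval1 x)); apply: eq_bigr => j _.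
exact: mpoly.mevalXU.
Qed.

Lemma esym0 (R : realType) (m : nat) (x : 'I_m -> R) : esym x 0 = 1.
Proof.
rewrite esymE (big_pred1 finset.set0) ?big_set0// => h.
by rewrite /= cards_eq0.
Qed.

Lemma esym_geqnE (R : realType) (m : nat) (x : 'I_m -> R) (k : nat) :
  (m < k)%N -> esym x k = 0.
Proof. by move=> mk; rewrite /esym mpoly.mesym_geqnE// mpoly.meval0. Qed.

(* Used for 1 <= i only. *)
Definition esym_ratio (R : realType) (p q : nat)
    (a : 'I_p -> R) (b : 'I_q -> R) (i : nat) : R :=
  (esym b i - esym a i) / esym a i.-1.

(* The maximum of [esym_ratio a b i] over 1 <= i <= q, for 1 <= q: a realType
   has no least element, so the fold starts from the i = 1 term. *)
Definition max_esym_ratio (R : realType) (p q : nat)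
    (a : 'I_p -> R) (b : 'I_q -> R) : R :=
  \big[Num.max/esym_ratio a b 1]_(1 <= i < q.+1) esym_ratio a b i.

(* Main.v *)
(** By the choice of [c], expanding both sides in powers of [n] gives
    [prod_i (b_i + n) <= (c + n) prod_i (a_i + n)], so the series dominates
    [G := 0F1(; c; x)] coefficientwise.  From [x G'' + c G' = G], the function
    [W := x G'^2 + c G G' - G^2] satisfies [(x^c W)' = x^c G'^2 >= 0], hence
    [W >= 0].  This quadratic inequality gives [G'/G >= 2 / (c + sqrt (4 x + c^2))],
    and the right-hand side is the logarithmic derivative of the lower bound. *)
Require Import Defs.
From mathcomp Require Import all_boot all_order all_algebra.
From mathcomp Require Import all_classical all_reals all_analysis.
From mathcomp Require Import ring.

Import Order.TTheory GRing.Theory Num.Theory.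
Import numFieldNormedType.Exports.

Local Open Scope ring_scope.

Definition bessel_coeff (R : realType) (c : R) (n : nat) : R :=
  (rising c n * n`!%:R)^-1.

(* [bessel c] is 0F1(; c; x), a rescaled modified Bessel function. *)
Definition bessel (R : realType) (c x : R) : R :=
  limn (pseries (bessel_coeff R c) x).

(** * Power series, and the function [bessel] with its derivative and differential equation *)

Section PowerSeries.
Context {R : realType}.
Implicit Types (f g : nat -> R) (c x : R).

(** Comparison with the exponential series of [M * (|x| + 1)] gives convergence at [|x| + 1], hence
    at the strictly interior point [x], whatever its sign. *)
Lemma is_cvg_pseries_exp_bound f M x : 0 <= M ->
  (forall n, 0 <= f n <= M ^+ n / n`!%:R) -> cvgn (pseries f x).
Proof.
move=> M0 fM; have f0 n : 0 <= f n by have /andP[] := fM n.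
have K0 : 0 <= `|x| + 1 by rewrite addr_ge0.
apply: (@is_cvg_pseries_inside _ f (`|x| + 1)); last first.
  by rewrite (ger0_norm K0) ltrDl.
apply: (@series_le_cvg _ _ (exp_coeff (M * (`|x| + 1)))).
- by move=> n; rewrite mulr_ge0// exprn_ge0.
- by move=> n; rewrite /exp_coeff /= divr_ge0// exprn_ge0// mulr_ge0.
- move=> n; rewrite /exp_coeff /= exprMn mulrAC ler_wpM2r ?exprn_ge0//.
  by have /andP[] := fM n.
- exact: is_cvg_series_exp_coeff.
Qed.

Lemma le_lim_pseries f g x : 0 <= x -> (forall n, f n <= g n) ->
  cvgn (pseries f x) -> cvgn (pseries g x) ->
  limn (pseries f x) <= limn (pseries g x).
Proof.
move=> x0 fg cf cg; apply: ler_lim => //; apply: nearW => n.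
by apply: ler_sum => i _; rewrite ler_wpM2r// exprn_ge0.
Qed.

Lemma ge_head_pseries f x : 0 <= x -> (forall n, 0 <= f n) ->
  cvgn (pseries f x) -> f 0%N <= limn (pseries f x).
Proof.
move=> x0 f0 cf; have -> : f 0%N = pseries f x 1%N.
  by rewrite /pseries /series /= big_nat1 expr0 mulr1.
apply: nondecreasing_cvgn_le => //; apply/nondecreasing_seqP => n.
by rewrite /pseries /series /= big_nat_recr//= lerDl mulr_ge0// exprn_ge0.
Qed.

Lemma rising0 c : rising c 0 = 1.
Proof. by rewrite /rising big_ord0. Qed.

Lemma risingS c n : rising c n.+1 = rising c n * (c + n%:R).
Proof. by rewrite /rising big_ord_recr. Qed.

Lemma risingSl c n : rising c n.+1 = c * rising (c + 1) n.
Proof.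
rewrite /rising big_ord_recl /= addr0; congr (_ * _).
by apply: eq_bigr => i _; rewrite /bump /= natrD addrA.
Qed.

Lemma rising_gt0 c n : 0 < c -> 0 < rising c n.
Proof. by move=> c0; apply: prodr_gt0 => i _; rewrite ltr_wpDr. Qed.

Lemma ge_expr_rising c n : 0 < c -> c ^+ n <= rising c n.
Proof.
move=> c0; rewrite -[n in X in X <= _]card_ord -prodr_const.
by apply: ler_prod => i _; rewrite (ltW c0) lerDl ler0n.
Qed.

Lemma bessel_coeff_ge0 c n : 0 < c -> 0 <= bessel_coeff R c n.
Proof. by move=> c0; rewrite invr_ge0 mulr_ge0// ltW// rising_gt0. Qed.

Lemma is_cvg_bessel c x : 0 < c -> cvgn (pseries (bessel_coeff R c) x).
Proof.
move=> c0; apply: (@is_cvg_pseries_exp_bound _ c^-1); first by rewrite invr_ge0 ltW.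
move=> n; rewrite bessel_coeff_ge0//= /bessel_coeff invfM ler_wpM2r ?invr_ge0//.
rewrite exprVn lef_pV2 ?posrE ?exprn_gt0 ?rising_gt0//.
exact: ge_expr_rising.
Qed.

Lemma bessel_ge1 c x : 0 < c -> 0 <= x -> 1 <= bessel R c x.
Proof.
move=> c0 x0; have <- : bessel_coeff R c 0 = 1.
  by rewrite /bessel_coeff rising0 fact0 mulr1 invr1.
apply: ge_head_pseries => //.
  by move=> n; exact: bessel_coeff_ge0.
exact: is_cvg_bessel.
Qed.

(** Since (c)_{n+1} = c (c+1)_n, differentiating only shifts the parameter, so all derivatives of
    [bessel] are again multiples of [bessel]. *)
Lemma bessel_coeff_diffs c : 0 < c ->
  pseries_diffs (bessel_coeff R c) = c^-1 *: bessel_coeff R (c + 1).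
Proof.
move=> c0; apply/funext => n.
rewrite /pseries_diffs /bessel_coeff risingSl factS natrM /= fctE.
have h1 : rising (c + 1) n != 0 by rewrite gt_eqF// rising_gt0// addr_gt0.
have h2 : n`!%:R != 0 :> R by rewrite pnatr_eq0 -lt0n fact_gt0.
have h3 : c != 0 by rewrite gt_eqF.
have h4 : 1 + n%:R != 0 :> R by rewrite nat1r pnatr_eq0.
rewrite -nat1r /GRing.scale /=; field.
by rewrite h1 h2 h3 h4.
Qed.

Lemma pseriesZ k f x : pseries (k *: f) x = series (k *: (fun n => f n * x ^+ n)).
Proof.
by congr (series _); apply/funext => n; rewrite !fctE /GRing.scale /= mulrA.
Qed.

Lemma lim_pseriesZ k f x : cvgn (pseries f x) ->
  limn (pseries (k *: f) x) = k * limn (pseries f x).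
Proof. by rewrite pseriesZ; exact: lim_seriesZ. Qed.

Lemma is_cvg_pseriesZ k f x : cvgn (pseries f x) -> cvgn (pseries (k *: f) x).
Proof. by rewrite pseriesZ; exact: is_cvg_seriesZ. Qed.

Lemma is_derive_bessel c x : 0 < c ->
  is_derive x 1 (bessel R c) (c^-1 * bessel R (c + 1) x).
Proof.
move=> c0; have c1 : 0 < c + 1 by rewrite addr_gt0.
rewrite /bessel -lim_pseriesZ; last exact: is_cvg_bessel.
(* Termwise differentiation asks that the series and its first two formal derivatives converge at a
   radius beyond [|x|]. *)
rewrite -bessel_coeff_diffs//; apply: (@pseries_snd_diffs _ _ (`|x| + 1)).
- exact: is_cvg_bessel.
- by rewrite bessel_coeff_diffs//; apply/is_cvg_pseriesZ/is_cvg_bessel.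
- rewrite bessel_coeff_diffs//.
  have -> : pseries_diffs (c^-1 *: bessel_coeff R (c + 1)) =
      c^-1 *: pseries_diffs (bessel_coeff R (c + 1)).
    by apply/funext => n; rewrite /pseries_diffs !fctE /GRing.scale /= mulrCA.
  rewrite bessel_coeff_diffs//; do 2 apply: is_cvg_pseriesZ.
  by apply: is_cvg_bessel; rewrite addr_gt0.
- by rewrite (ger0_norm (addr_ge0 _ _)) ?ltrDl.
Qed.

(** This is x G'' + c G' = G with both derivatives written through shifted parameters.
    Coefficientwise it reads 1/(c)_n = (1 + n/c) / (c+1)_n. *)
Lemma besselE c x : 0 < c ->
  x * ((c * (c + 1))^-1 * bessel R (c + 1 + 1) x) + bessel R (c + 1) x =
  bessel R c x.
Proof.
move=> c0; have c1 : 0 < c + 1 by rewrite addr_gt0.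
have c2 : 0 < c + 1 + 1 by rewrite addr_gt0.
pose d := pseries_diffs (bessel_coeff R (c + 1)).
have dE : d = (c + 1)^-1 *: bessel_coeff R (c + 1 + 1) by exact: bessel_coeff_diffs.
have cd : cvgn (pseries d x) by rewrite dE; apply/is_cvg_pseriesZ/is_cvg_bessel.
(* The derivative series is re-indexed to carry the factor [i * x ^+ i.-1], so that multiplying by
   [x] realigns the powers with those of the other series. *)
have cvg1 := pseries_diffs_equiv cd.
rewrite [LHS](_ : _ = c^-1 * x * limn (pseries d x) + bessel R (c + 1) x); last first.
  rewrite dE lim_pseriesZ; last exact: is_cvg_bessel.
  by rewrite -/(bessel _ _ _) invfM; ring.
rewrite [RHS]/bessel; apply/esym/cvg_lim => //.
have -> : pseries (bessel_coeff R c) x =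
    (fun n => c^-1 * x * series (fun i => i%:R * bessel_coeff R (c + 1) i * x ^+ i.-1) n
              + pseries (bessel_coeff R (c + 1)) x n).
  apply/funext => n.
  rewrite /pseries /series /= mulr_sumr -big_split /=; apply: eq_bigr => i _.
  have xi : x * (i%:R * bessel_coeff R (c + 1) i * x ^+ i.-1) =
      i%:R * bessel_coeff R (c + 1) i * x ^+ i.
    by case: i => [|i]; rewrite ?mul0r ?mulr0// exprS /=; ring.
  rewrite -mulrA xi /bessel_coeff.
  have E : c * rising (c + 1) i = rising c i * (c + i%:R) by rewrite -risingSl risingS.
  have -> : rising c i = c * rising (c + 1) i / (c + i%:R).
    by rewrite E mulfK// gt_eqF// ltr_wpDr.
  have h1 : rising (c + 1) i != 0 by rewrite gt_eqF// rising_gt0.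
  have h2 : i`!%:R != 0 :> R by rewrite pnatr_eq0 -lt0n fact_gt0.
  have h3 : c != 0 by rewrite gt_eqF.
  have h4 : c + i%:R != 0 by rewrite gt_eqF// ltr_wpDr.
  by field; rewrite h1 h2 h3 h4.
apply: cvgD; last exact: is_cvg_bessel.
by apply: cvgM; [exact: cvg_cst|exact: cvg1].
Qed.

End PowerSeries.

(** * Coefficientwise comparison through elementary symmetric polynomials *)

Section Comparison.
Context {R : realType}.

(** Expanding the product chooses a set [h] of factors contributing [x i], the others contributing
    [t]; the sets are then grouped by cardinality. *)
Lemma prodrD_esym (m : nat) (x : 'I_m -> R) (t : R) :
  \prod_(i < m) (x i + t) = \sum_(k < m.+1) Defs.esym x k * t ^+ (m - k).
Proof.
rewrite bigA_distr /=.
have card_lt (h : {set 'I_m}) : (#|h| < m.+1)%N.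
  by rewrite ltnS -[X in (_ <= X)%N]card_ord max_card.
rewrite (partition_big (fun h : {set 'I_m} => Ordinal (card_lt h)) xpredT)//=.
apply: eq_bigr => k _; rewrite esymE mulr_suml.
apply: eq_big => [h|h /eqP hk]; first by rewrite -val_eqE.
rewrite (bigID (mem h))/=; congr (_ * _).
  by apply: eq_bigr => i ->.
rewrite (eq_bigr (fun=> t)) => [|i /negbTE -> //].
rewrite prodr_const; congr (_ ^+ _).
have <- : #|h| = k by rewrite -hk.
have := cardC (mem h); rewrite card_ord => mE.
transitivity (#|h| + #|[predC h]| - #|h|)%N; last by rewrite mE.
by rewrite addKn; apply: eq_card.
Qed.

Lemma esym_gt0 (m : nat) (x : 'I_m -> R) (k : nat) :
  (forall i, 0 < x i) -> (k <= m)%N -> 0 < Defs.esym x k.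
Proof.
move=> x0 km; rewrite esymE.
have /card_gt0P[h] : (0 < #|[set h : {set 'I_m} | #|h| == k]|)%N.
  by rewrite card_draws card_ord bin_gt0.
rewrite inE => hk.
rewrite (bigD1 h)//= ltr_wpDr ?prodr_gt0//.
by apply: sumr_ge0 => j _; apply: prodr_ge0 => i _; exact: ltW.
Qed.

Lemma le_max_esym_ratio (p q : nat) (a : 'I_p -> R) (b : 'I_q -> R) (i : nat) :
  (0 < i <= q)%N -> esym_ratio a b i <= max_esym_ratio a b.
Proof.
by move=> iq; apply: le_bigmax_seq => //; rewrite mem_index_iota.
Qed.

(** The top ratio is positive: its numerator is just e_{q+1}(b), because e_{q+1}(a) = 0. *)
Lemma max_esym_ratio_gt0 (q : nat) (a : 'I_q -> R) (b : 'I_q.+1 -> R) :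
  (forall i, 0 < a i) -> (forall i, 0 < b i) -> 0 < max_esym_ratio a b.
Proof.
move=> a0 b0; apply: (@lt_le_trans _ _ (esym_ratio a b q.+1)).
  by rewrite /esym_ratio (esym_geqnE a)// subr0 divr_gt0 ?esym_gt0.
by apply: le_max_esym_ratio; rewrite leqnn.
Qed.

(** Comparing coefficients of powers of t, the claim becomes e_k(b) <= e_k(a) + c e_{k-1}(a), which
    for k >= 1 says that c bounds the k-th ratio. *)
Lemma prodrD_le_max_esym_ratio (q : nat) (a : 'I_q -> R) (b : 'I_q.+1 -> R) (t : R) :
  (forall i, 0 < a i) -> 0 <= t ->
  \prod_(i < q.+1) (b i + t) <= (max_esym_ratio a b + t) * \prod_(i < q) (a i + t).
Proof.
move=> a0 t0; set c := max_esym_ratio a b.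
(* At [k = 0] the term e_{k-1} is read as 0; at [k = q.+1] the term e_k(a) vanishes. *)
have -> : (c + t) * \prod_(i < q) (a i + t) =
    \sum_(k < q.+2) (Defs.esym a k + (if (k : nat) is j.+1 then c * Defs.esym a j else 0))
      * t ^+ (q.+1 - k).
  under [RHS]eq_bigr do rewrite mulrDl.
  rewrite big_split /= big_ord_recr /= esym_geqnE// mul0r addr0 addrC mulrDl.
  rewrite prodrD_esym [X in _ = X + _]big_ord_recl /= mul0r add0r !mulr_sumr.
  congr (_ + _); apply: eq_bigr => k _.
    by rewrite /bump /= subSS mulrA.
  by rewrite mulrCA -exprS subSn// -ltnS.
rewrite prodrD_esym; apply: ler_sum => -[[|k] /= kq] _.
  by rewrite !esym0 addr0.
rewrite ler_wpM2r ?exprn_ge0//.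
have : esym_ratio a b k.+1 <= c by apply: le_max_esym_ratio.
rewrite /esym_ratio ler_pdivrMr; last by rewrite esym_gt0// -ltnS.
by rewrite lerBlDl.
Qed.

Lemma le_hypergeo_coeff (q : nat) (a : 'I_q -> R) (b : 'I_q.+1 -> R) (n : nat) :
  (forall i, 0 < a i) -> (forall i, 0 < b i) ->
  bessel_coeff R (max_esym_ratio a b) n <= hypergeo_coeff a b n.
Proof.
move=> a0 b0; have c0 := max_esym_ratio_gt0 _ _ _ a0 b0.
have n0 : 0 < n`!%:R :> R by rewrite ltr0n fact_gt0.
rewrite /bessel_coeff /hypergeo_coeff !invfM mulrA ler_pM2r ?invr_gt0//.
have B0 : 0 < \prod_(i < q.+1) rising (b i) n.
  by apply: prodr_gt0 => i _; exact: rising_gt0.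
rewrite ler_pdivlMr// mulrC ler_pdivrMr ?rising_gt0//.
(* Exchanging the products groups the factors by the shift [k < n]; the product inequality then
   applies at each [t = k]. *)
rewrite /rising exchange_big /= [X in X * _]exchange_big /= -big_split /=.
apply: ler_prod => k _; rewrite prodr_ge0 => [|i _]; last by rewrite addr_ge0// ltW.
by rewrite mulrC prodrD_le_max_esym_ratio.
Qed.

(** Factor by factor, u + k <= (1 + u/v) (v + k). This crude bound serves only for convergence. *)
Lemma rising_le_expr (u v : R) (n : nat) : 0 < u -> 0 < v ->
  rising u n <= (1 + u / v) ^+ n * rising v n.
Proof.
move=> u0 v0; rewrite /rising -[n in X in _ <= X * _]card_ord -prodr_const -big_split /=.
apply: ler_prod => k _; rewrite addr_ge0 ?(ltW u0)//=.
have -> : (1 + u / v) * (v + k%:R) = u + k%:R + (v + u / v * k%:R).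
  by field; rewrite gt_eqF.
by rewrite lerDl addr_ge0 ?mulr_ge0 ?invr_ge0 ?(ltW u0) ?(ltW v0).
Qed.

Lemma is_cvg_hypergeo (q : nat) (a : 'I_q -> R) (b : 'I_q.+1 -> R) (x : R) :
  (forall i, 0 < a i) -> (forall i, 0 < b i) ->
  cvgn (pseries (hypergeo_coeff a b) x).
Proof.
(* Each [a i] is paired with [b i], at a cost of [K ^+ n] in all. The unpaired last [b] satisfies
   (b)_n >= b^n, whence the exponential bound with [M = K / b ord_max]. *)
move=> a0 b0; pose K := \prod_(i < q) (1 + a i / b (widen_ord (leqnSn q) i)).
have K0 : 0 <= K by apply: prodr_ge0 => i _; rewrite addr_ge0 ?divr_ge0 ?ltW.
have n0 n : 0 < n`!%:R :> R by rewrite ltr0n fact_gt0.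
have B0 n : 0 < \prod_(i < q.+1) rising (b i) n.
  by apply: prodr_gt0 => i _; exact: rising_gt0.
apply: (@is_cvg_pseries_exp_bound _ _ (K / b ord_max)); first by rewrite divr_ge0// ltW.
move=> n; apply/andP; split.
  rewrite divr_ge0 ?mulr_ge0 ?(ltW (B0 n)) ?(ltW (n0 n))//.
  by apply: prodr_ge0 => i _; exact/ltW/rising_gt0.
rewrite /hypergeo_coeff invfM mulrA ler_pM2r ?invr_gt0// ler_pdivrMr//.
rewrite big_ord_recr /= expr_div_n.
have P0 : 0 <= \prod_(i < q) rising (b (widen_ord (leqnSn q) i)) n.
  by apply: prodr_ge0 => i _; exact/ltW/rising_gt0.
apply: (@le_trans _ _ (K ^+ n * \prod_(i < q) rising (b (widen_ord (leqnSn q) i)) n)).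
  rewrite /K -prodrXl -big_split /=; apply: ler_prod => i _.
  by rewrite ltW ?rising_gt0//= rising_le_expr.
rewrite [leRHS](_ : _ = K ^+ n * \prod_(i < q) rising (b (widen_ord (leqnSn q) i)) n
  * (rising (b ord_max) n / b ord_max ^+ n)); last by ring.
rewrite ler_peMr ?mulr_ge0 ?exprn_ge0// ler_pdivlMr ?exprn_gt0// mul1r.
exact: ge_expr_rising.
Qed.

End Comparison.

(** * The lower bound for [bessel] *)

Section BesselBound.
Context {R : realType}.
Implicit Types (c x : R).

Lemma bessel_riccati c x : 0 < c -> 0 < x ->
  bessel R c x ^+ 2 <= x * (c^-1 * bessel R (c + 1) x) ^+ 2
                       + c * (bessel R c x * (c^-1 * bessel R (c + 1) x)).
Proof.
move=> c0 x0; have c1 : 0 < c + 1 by rewrite addr_gt0.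
pose G := bessel R c.
pose G1 t := c^-1 * bessel R (c + 1) t.
pose G2 t := c^-1 * ((c + 1)^-1 * bessel R (c + 1 + 1) t).
have dG (t : R) : is_derive t 1 G (G1 t) by exact: is_derive_bessel.
have dG1 (t : R) : is_derive t 1 G1 (G2 t).
  have dB := is_derive_bessel (c + 1) t c1.
  exact: is_deriveZ.
have ode t : t * G2 t + c * G1 t = G t.
  by rewrite /G -besselE// /G1 /G2; field; rewrite !gt_eqF.
pose W t := t * G1 t ^+ 2 + c * (G t * G1 t) - G t ^+ 2.
pose W1 t := G1 t ^+ 2 + t * (2 * G1 t * G2 t) + c * (G1 t * G1 t + G t * G2 t)
  - 2 * G t * G1 t.
have dW (t : R) : is_derive t 1 W (W1 t).
  rewrite /W; apply: is_derive_eq.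
  rewrite /W1 /GRing.scale /=; ring.
have xW t : t * W1 t + c * W t = t * G1 t ^+ 2.
  rewrite /W1 /W -(ode t); ring.
rewrite -subr_ge0 -/(W x).
have cW (t : R) : {for t, continuous W}.
  by apply/differentiable_continuous/derivable1_diffP; have [] := dW t.
(* The factor t^c is an integrating factor: it turns t W' + c W = t G'^2 into F' = t^c G'^2 >= 0. *)
pose F t := t `^ c * W t.
have dF (t : R) : t \in `]0, x[ -> is_derive t 1 F (t `^ c * G1 t ^+ 2).
  rewrite in_itv /= => /andP[t0 _].
  have dp := is_derive1_powR c t0.
  rewrite /F; apply: is_derive_eq.
  have E : t `^ c = t * t `^ (c - 1).
    rewrite -{2}(powRr1 (ltW t0)) -powRD; last by rewrite (gt_eqF t0) implybT.
    by congr (_ `^ _); ring.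
  rewrite /GRing.scale /= E.
  transitivity (t `^ (c - 1) * (t * W1 t + c * W t)); first by ring.
  rewrite xW; ring.
(* The power t^c need not be differentiable at 0, so continuity there is shown separately, from c >
   0. *)
have cF : {within `[0, x], continuous F}%classic.
  apply/continuous_within_itvP => //; split.
  - move=> t tx; apply/differentiable_continuous/derivable1_diffP.
    by have [] := dF _ tx.
  - rewrite /F powR0 ?gt_eqF// mul0r.
    rewrite -[X in (_ --> X)%classic](mul0r (W 0)).
    apply: cvgM; first exact: powR_cvg0.
    by apply: cvg_at_right_filter; exact: cW.
  - apply: cvg_at_left_filter.
    apply: cvgM; last exact: cW.
    have dp := is_derive1_powR c x0.
    have : {for x, continuous (fun t : R => t `^ c)}; last by [].
    by apply/differentiable_continuous/derivable1_diffP; have [] := dp.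
have [t tx] := MVT x0 dF cF.
rewrite /F powR0 ?gt_eqF// mul0r !subr0 => FE.
have : 0 <= x `^ c * W x by rewrite FE mulr_ge0 ?(ltW x0)// mulr_ge0 ?sqr_ge0 ?powR_ge0.
by rewrite pmulr_rge0// powR_gt0.
Qed.

(** With s the square root, 2 / (c + s) = (s - c) / (2 x) is the positive root of x r^2 + c r = 1. A
    smaller r = G'/G would contradict [bessel_riccati]. *)
Lemma bessel_log_derive_ge c x : 0 < c -> 0 < x ->
  2 / (c + Num.sqrt (4 * x + c ^+ 2)) <= c^-1 * bessel R (c + 1) x / bessel R c x.
Proof.
move=> c0 x0; have c1 : 0 < c + 1 by rewrite addr_gt0.
have := bessel_riccati _ _ c0 x0.
have G_gt0 : 0 < bessel R c x.
  by apply: (lt_le_trans ltr01); apply: bessel_ge1 => //; exact: ltW.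
have G1_gt0 : 0 < c^-1 * bessel R (c + 1) x.
  rewrite mulr_gt0 ?invr_gt0//.
  by apply: (lt_le_trans ltr01); apply: bessel_ge1 => //; exact: ltW.
move: G_gt0 G1_gt0; set G := bessel R c x; set G1 := _ * bessel _ _ x => G0 G10 H.
set s := Num.sqrt _.
have s2 : s ^+ 2 = 4 * x + c ^+ 2 by rewrite sqr_sqrtr// addr_ge0 ?sqr_ge0 ?mulr_ge0 ?ltW.
have s0 : 0 <= s by exact: sqrtr_ge0.
have cs : c < s.
  by rewrite -ltr_sqr ?nnegrE ?(ltW c0)// s2 ltrDr mulr_gt0.
have cs0 : 0 < c + s by rewrite ltr_wpDr.
rewrite ler_pdivrMr// mulrAC ler_pdivlMr//.
rewrite leNgt; apply/negP => H2.
suff : x * G1 ^+ 2 + c * (G * G1) < G ^+ 2 by rewrite ltNge H.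
have x_eq : x = (s - c) * (c + s) / 4.
  have -> : (s - c) * (c + s) = s ^+ 2 - c ^+ 2 by ring.
  by rewrite s2; field.
set t := G1 * (c + s) in H2.
have t0 : 0 < t by rewrite mulr_gt0.
(* [4 (x G1^2 + c G G1) (c + s) = (s - c) t^2 + 4 c G t], increasing in [t],
   equals [4 (c + s) G^2] at [t = 2 G]. *)
have E : (4 * (c + s)) * (x * G1 ^+ 2 + c * (G * G1))
    = (s - c) * t ^+ 2 + 4 * c * G * t.
  by rewrite x_eq /t; field.
rewrite -(ltr_pM2l (_ : 0 < 4 * (c + s))); last by rewrite mulr_gt0.
rewrite E.
have h1 : (s - c) * t ^+ 2 < (s - c) * (2 * G) ^+ 2.
  by rewrite ltr_pM2l ?subr_gt0// ltr_sqr// nnegrE ltW// mulr_gt0.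
have h2 : 4 * c * G * t < 4 * c * G * (2 * G) by rewrite ltr_pM2l// !mulr_gt0.
apply: (lt_le_trans (ltrD h1 h2)); rewrite le_eqVlt; apply/orP; left.
by apply/eqP; ring.
Qed.

(** Let L be the logarithm of the left side. Then L' = 2 / (c + s), so D = ln G - L has D' >= 0 for
    positive arguments, and D(0) >= 0. *)
Lemma le_bessel c x : 0 < c -> 0 <= x ->
  expR (Num.sqrt (4 * x + c ^+ 2) - c)
    * (2^-1 + (2 * c)^-1 * Num.sqrt (4 * x + c ^+ 2)) `^ (- c)
  <= bessel R c x.
Proof.
move=> c0 x0.
pose s t := Num.sqrt (4 * t + c ^+ 2).
pose L t := s t - c - c * ln (2^-1 + (2 * c)^-1 * s t).
have arg_gt0 t : 0 < 2^-1 + (2 * c)^-1 * s t.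
  by rewrite ltr_wpDr// mulr_ge0 ?sqrtr_ge0// invr_ge0 mulr_ge0// ltW.
have G_gt0 t : 0 <= t -> 0 < bessel R c t.
  by move=> t0; apply: (lt_le_trans ltr01); exact: bessel_ge1.
have -> : expR (s x - c) * (2^-1 + (2 * c)^-1 * s x) `^ (- c) = expR (L x).
  by rewrite /powR gt_eqF// -expRD /L mulNr.
rewrite -[leRHS](@lnK _ (bessel R c x)) ?posrE ?G_gt0// ler_expR -subr_ge0.
pose D t := ln (bessel R c t) - L t.
pose D1 t := c^-1 * bessel R (c + 1) t / bessel R c t - 2 / (c + s t).
have dD (t : R) : 0 <= t -> is_derive t 1 D (D1 t).
  move=> t0; have dG := is_derive_bessel c t c0.
  have q0 : 0 < 4 * t + c ^+ 2 by rewrite ltr_wpDl ?mulr_ge0// exprn_gt0.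
  have s0 : 0 < s t by rewrite sqrtr_gt0.
  have dlG : is_derive t 1 (@ln R \o bessel R c) (c^-1 * bessel R (c + 1) t / bessel R c t).
    have dl := is_derive1_ln (G_gt0 _ t0).
    by apply: is_derive_eq; rewrite /GRing.scale /= mulrC.
  have ds : is_derive t 1 s (2 / s t).
    have dq : is_derive t 1 (fun t => 4 * t + c ^+ 2) 4.
      by apply: is_derive_eq; rewrite /GRing.scale /=; ring.
    have dr := is_derive1_sqrt q0.
    rewrite (_ : s = Num.sqrt \o (fun t => 4 * t + c ^+ 2))//.
    apply: is_derive_eq; rewrite /GRing.scale /= -/(s t); field.
    by rewrite gt_eqF.
  have da : is_derive t 1 (fun t => 2^-1 + (2 * c)^-1 * s t) ((2 * c)^-1 * (2 / s t)).
    by apply: is_derive_eq; rewrite /GRing.scale /=; ring.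
  have dla : is_derive t 1 (@ln R \o (fun t => 2^-1 + (2 * c)^-1 * s t))
      ((2^-1 + (2 * c)^-1 * s t)^-1 * ((2 * c)^-1 * (2 / s t))).
    have dl := is_derive1_ln (arg_gt0 t).
    by apply: is_derive_eq; rewrite /GRing.scale /= mulrC.
  rewrite (_ : D = (@ln R \o bessel R c) -
     ((s - cst c) - c *: (@ln R \o (fun t => 2^-1 + (2 * c)^-1 * s t))))//.
  apply: is_derive_eq; rewrite /D1 /GRing.scale /=.
  have h : c + s t != 0 by rewrite gt_eqF// addr_gt0.
  field.
  by rewrite !gt_eqF ?G_gt0 ?addr_gt0.
(* At 0 the square root equals [c], so [L 0 = 0], while [bessel] is at least 1. *)
have D0 : 0 <= D 0.
  rewrite /D /L /s mulr0 add0r sqrtr_sqr (ger0_norm (ltW c0)).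
  have -> : 2^-1 + (2 * c)^-1 * c = 1 by field; rewrite gt_eqF.
  by rewrite ln1 mulr0 subrr !subr0 ln_ge0 ?bessel_ge1.
rewrite -/(D x); move: x0; rewrite le_eqVlt => /predU1P[<-//|x0].
have [t||t tx DE] := @MVT _ D D1 0 x x0.
- by rewrite in_itv /= => /andP[t0 _]; apply: dD; exact: ltW.
- apply: derivable_within_continuous => t; rewrite in_itv /= => /andP[t0 _].
  by have [] := dD _ t0.
rewrite -(subrK (D 0) (D x)) DE subr0 addr_ge0// mulr_ge0 ?(ltW x0)//.
move: tx; rewrite in_itv /= => /andP[t0 _].
by rewrite subr_ge0 bessel_log_derive_ge.
Qed.
End BesselBound.

Theorem theorem10 (R : realType) (q : nat) (q_ge1 : (1 <= q)%N)
    (a : 'I_q.-1 -> R) (b : 'I_q -> R)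
    (a_gt0 : forall i, 0 < a i) (b_gt0 : forall i, 0 < b i)
    (c : R) (c_max : c = max_esym_ratio a b) :
  0 < c /\
  forall x : R, 0 <= x ->
    expR (Num.sqrt (4 * x + c ^+ 2) - c)
      * (2^-1 + (2 * c)^-1 * Num.sqrt (4 * x + c ^+ 2)) `^ (- c)
    <= hypergeo a b x.
Proof.
(* Writing the number of lower parameters as [q.+1] makes [q.-1] compute, matching the form of the
   comparison lemmas. *)
case: q q_ge1 a b a_gt0 b_gt0 c_max => [//|q] _ /= a b a0 b0 ->.
have c0 := max_esym_ratio_gt0 _ _ _ a0 b0.
split=> // x x0; apply: (le_trans (le_bessel _ _ c0 x0)).
apply: le_lim_pseries => //; first by move=> n; exact: le_hypergeo_coeff.
  exact: is_cvg_bessel.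
exact: is_cvg_hypergeo.
Qed.
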